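(* Let $X$ be a complex Banach space of dimension at least $2$ and let $\mathfrak{N}$ be a subspace lattice in $X$ which is a nest. Then $\mathfrak{N}$ is strongly reflexive, that is, $N_{*}=N$ for every $N\in\mathfrak{N}$; in particular, $\mathfrak{N}=\operatorname{Lat}\bigl(\operatorname{Rk}_1(\operatorname{Alg}(\mathfrak{N}))\bigr)$.
   Context: A subspace of $X$ means a closed linear subspace; $\mathfrak{C}(X)$ is the family of all subspaces of $X$. Joins and meets: $\bigvee_j M_j$ is the closed linear span of the $M_j$, $\bigwedge_j M_j=\bigcap_j M_j$, with $\bigvee\emptyset=\{0\}$ and $\bigwedge\emptyset=X$. A subspace lattice in $X$ is a family $\mathfrak{L}\subseteq\mathfrak{C}(X)$ containing $\{0\}$ and $X$ and closed under arbitrary joins and meets. A nest is a subspace lattice totally ordered by inclusion. For a subspace lattice $\mathfrak{L}$ and $M,N\in\mathfrak{C}(X)$, put $M_{-}=\bigvee\{K\in\mathfrak{L}: M\not\subseteq K\}$ and $N_{*}=\bigwedge\{M_{-}: M\in\mathfrak{L},\ M\not\subseteq N\}$ (here with $\mathfrak{L}=\mathfrak{N}$). $\mathfrak{L}$ is strongly reflexive if $N_*=N$ for all $N\in\mathfrak{L}$. $\mathcal{B}(X)$ is the algebra of bounded linear operators on $X$. $\operatorname{Alg}(\mathfrak{L})=\{A\in\mathcal{B}(X): AM\subseteq M\text{ for all }M\in\mathfrak{L}\}$; $\operatorname{Rk}_1(\mathcal{A})$ is the set of all rank-one operators in $\mathcal{A}$; $\operatorname{Lat}(\mathcal{T})=\{M\in\mathfrak{C}(X):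 TM\subseteq M\text{ for all }T\in\mathcal{T}\}$. *)

(* Defs.v *)
From HB Require Import structures.
From mathcomp Require Import all_boot all_order all_algebra complex.
From mathcomp Require Import boolp classical_sets functions reals.
From mathcomp Require Import topology normedtype.

Set Implicit Arguments.
Unset Strict Implicit.
Unset Printing Implicit Defensive.

Import Order.TTheory GRing.Theory Num.Theory.
Import numFieldNormedType.Exports.

Local Open Scope classical_set_scope.
Local Open Scope ring_scope.

Section SubspaceLattices.
Context {K : numFieldType} {X : normedModType K}.
Implicit Types (M N S : set X) (F L : set (set X)) (T : set {linear X -> X}).

Definition linearly_independent (n : nat) (v : 'I_n -> X) : Prop :=
  forall a : 'I_n -> K, \sum_i a i *: v i = 0 -> forall i, a i = 0.

(* X may be infinite-dimensional. *)
Definition dim_at_least (n : nat) : Prop :=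
  exists v : 'I_n -> X, linearly_independent v.

Definition closed_subspace M : Prop := submod_closed (mem M) /\ closed M.

Definition linear_span S : set X :=
  [set x | exists (n : nat) (a : 'I_n -> K) (v : 'I_n -> X),
     (forall i, S (v i)) /\ x = \sum_i a i *: v i].

(* The sum with n = 0 puts 0 in every span, so that join set0 = [set 0]. *)
Definition join F : set X := closure (linear_span (\bigcup_(M in F) M)).

Definition meet F : set X := \bigcap_(M in F) M.

Definition subspace_lattice L : Prop :=
  [/\ forall M, L M -> closed_subspace M,
      L [set 0] /\ L setT,
      forall F, F `<=` L -> L (join F) &
      forall F, F `<=` L -> L (meet F)].

Definition nest L : Prop :=
  subspace_lattice L /\
  forall M N, L M -> L N -> M `<=` N \/ N `<=` M.

Definition lower L M : set X := join [set K' | L K' /\ ~ M `<=` K'].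

Definition star L N : set X :=
  meet [set lower L M | M in [set M | L M /\ ~ M `<=` N]].

Definition strongly_reflexive L : Prop := forall N, L N -> star L N = N.

(* By linear_boundedP this is boundedness in the operator norm:
   |A x| <= r |x| for all x, for some (all large) r. *)
Definition bounded_operators : set {linear X -> X} :=
  [set A | bounded_near A (nbhs (0 : X))].

Definition Alg L : set {linear X -> X} :=
  [set A | bounded_operators A /\ forall M, L M -> A @` M `<=` M].

(* The range is a line. *)
Definition rank_one (A : {linear X -> X}) : Prop :=
  exists2 e : X, e != 0 & range A = [set c *: e | c in [set: K]].

Definition Rk1 T : set {linear X -> X} := [set A | T A /\ rank_one A].

Definition Lat T : set (set X) :=
  [set M | closed_subspace M /\ forall A, T A -> A @` M `<=` M].

End SubspaceLattices.

Arguments dim_at_least {K} X n.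

(* Main.v *)
From HB Require Import structures.
Require Import Defs.
From mathcomp Require Import all_boot all_order all_algebra complex.
From mathcomp Require Import boolp classical_sets functions reals.
From mathcomp Require Import topology normedtype.
From mathcomp Require Import ring lra.
Import Order.TTheory GRing.Theory Num.Theory.
Import numFieldNormedType.Exports.

Local Open Scope classical_set_scope.
Local Open Scope ring_scope.

(* In a nest, if M = star N were not inside N, then M would lie in lower M; but
   every K not containing M is contained in N, for otherwise
   M <= lower K <= K. Hence M <= lower M <= N, a contradiction.
   For the reflexivity, let M be invariant under the rank-one operators of
   Alg NN, and let N be the join of the K in NN contained in M. If M is not
   inside lower K, then by Hahn-Banach some functional f kills lower K but not
   some x in M, and every operator f(.) e with e in K lies in Alg NN, so that K
   is inside M, hence inside N. Contrapositively M <= star N = N. *)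

(** * Sublinear functionals and a Hahn-Banach theorem with cone constraints *)

Section Sublinear.
Context {R : realType} {V : lmodType R}.
Implicit Types (p q h : V -> R) (x y v : V) (a s : R).

Definition sublinear p : Prop :=
  (forall x y, p (x + y) <= p x + p y) /\
  (forall a x, 0 <= a -> p (a *: x) <= a * p x).

Lemma sublinear0 p : sublinear p -> p 0 = 0.
Proof.
move=> [pD pZ]; apply/eqP; rewrite eq_le.
have := pZ 0 0 (lexx 0); rewrite scale0r mul0r => -> /=.
by have := pD 0 0; rewrite addr0 lerDl.
Qed.

(** A reverse triangle inequality, which supplies the lower bounds that keep pointwise infima
    finite. *)
Lemma sublinearN_ge p x y : sublinear p -> p x - p (- y) <= p (y + x).
Proof.
move=> [pD _]; have := pD (- y) (y + x); rewrite addKr; lra.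
Qed.

(** Used for the inf-convolution with a cone and for the infimum of a chain. The members of [Q] need
    not be sublinear: the comparison member may depend on the points. *)
Lemma sublinear_inf (Q : set (V -> R)) :
    Q !=set0 ->
    (forall x, exists b, forall h, Q h -> b <= h x) ->
    (forall h1 h2 x y, Q h1 -> Q h2 ->
      exists2 h, Q h & h (x + y) <= h1 x + h2 y) ->
    (forall h a x, Q h -> 0 <= a -> exists2 h', Q h' & h' (a *: x) <= a * h x) ->
  exists2 q, sublinear q & forall x h, Q h -> q x <= h x.
Proof.
move=> [h0 Qh0] Qlb QD QZ; pose q x := inf [set h x | h in Q].
have qle x h : Q h -> q x <= h x.
  move=> Qh; apply: ge_inf; last by exists h.
  by have [b bP] := Qlb x; exists b => _ [h' Qh' <-]; exact: bP.
have qge x b : (forall h, Q h -> b <= h x) -> b <= q x.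
  move=> bP; apply: lb_le_inf; first by exists (h0 x), h0.
  by move=> _ [h Qh <-]; exact: bP.
clearbody q; exists q => //; split=> [x y|a x a0].
  (* The infimum is taken over [h1] with [q y] held fixed, then over [h2] with [h1 x] held fixed. *)
  rewrite -lerBlDr.
  apply: (qge x) => h1 Qh1; rewrite lerBlDr -lerBlDl.
  apply: (qge y) => h2 Qh2; rewrite lerBlDl.
  have [h Qh hle] := QD h1 h2 x y Qh1 Qh2.
  exact: le_trans (qle _ _ Qh) hle.
move: a0; rewrite le_eqVlt => /predU1P[<-|a0].
  have [h Qh hle] := QZ h0 0 x Qh0 (lexx 0).
  by rewrite mul0r; apply: le_trans (qle _ _ Qh) _; rewrite mul0r in hle.
rewrite -ler_pdivrMl //; apply: (qge x) => h Qh; rewrite ler_pdivrMl //.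
have [h' Qh' hle] := QZ h a x Qh (ltW a0).
exact: le_trans (qle _ _ Qh') hle.
Qed.

(** A cone in the product of [V] and [R]; a pair [(v, s)] encodes the constraint [0 <= g v + s] on a
    functional [g]. *)
Definition convex_cone (C : V -> R -> Prop) : Prop :=
  [/\ C 0 0,
      forall u v s t, C u s -> C v t -> C (u + v) (s + t) &
      forall a v s, 0 <= a -> C v s -> C (a *: v) (a * s)].

(* Inf-convolution of p with the cone: q y = inf over (v, s) in C of
   p (y + v) + s. *)
Lemma sublinear_cone p (C : V -> R -> Prop) :
    sublinear p -> convex_cone C -> (forall v s, C v s -> 0 <= p v + s) ->
  exists2 q, sublinear q & (forall x, q x <= p x) /\
    (forall v s, C v s -> q (- v) <= s).
Proof.
move=> sp [C0 CD CZ] Cp.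
pose Q : set (V -> R) :=
  [set h | exists v s, C v s /\ h = fun y => p (y + v) + s].
have [||||q sq qle] := sublinear_inf Q.
- by exists (fun y => p (y + 0) + 0), 0, 0.
(* Here [p (x + v) >= p v - p (- x)], and [p v + s >= 0] by hypothesis. *)
- move=> x; exists (- p (- x)) => _ [v [s [Cvs ->]]].
  by have := sublinearN_ge p v x sp; have := Cp _ _ Cvs; lra.
- move=> _ _ x y [u [s [Cu ->]]] [v [t [Cv ->]]].
  exists (fun y => p (y + (u + v)) + (s + t)).
    by exists (u + v), (s + t); split=> //; exact: CD.
  by rewrite /= addrACA; have := sp.1 (x + u) (y + v); lra.
- move=> _ a x [v [s [Cv ->]]] a0.
  exists (fun y => p (y + a *: v) + a * s).
    by exists (a *: v), (a * s); split=> //; exact: CZ.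
  by rewrite /= -scalerDr; have := sp.2 a (x + v) a0; lra.
exists q => //; split=> [x|v s Cvs].
  rewrite -[leRHS]addr0 -[in leRHS](addr0 x).
  by apply: (qle x (fun y => p (y + 0) + 0)); exists 0, 0.
have /(_ (ex_intro _ _ (ex_intro _ _ (conj Cvs erefl)))) :=
  qle (- v) (fun y => p (y + v) + s).
by rewrite /= addNr (sublinear0 p sp) add0r.
Qed.

(** Zorn's lemma on the sublinear functionals below [p]: all of them are at least [- p (- x)] at
    [x], so a nonempty chain has a finite pointwise infimum. *)
Lemma minimal_sublinear p : sublinear p ->
  exists2 q, sublinear q & (forall x, q x <= p x) /\
    (forall h, sublinear h -> (forall x, h x <= q x) -> h = q).
Proof.
move=> sp; pose T := {q | sublinear q /\ forall x, q x <= p x}.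
have Tlow (q : T) x : - p (- x) <= sval q x.
  case: q => q /= [sq qp]; have := sublinearN_ge q 0 x sq.
  by rewrite addr0 (sublinear0 q sq); have := qp (- x); lra.
have TP (q h : T) : sval q = sval h -> q = h.
  by case: q h => [q ?] [h ?] /=; exact: eq_exist.
(* The order is reversed, so that a maximal element for [r] is a minimal functional. *)
pose r (q h : T) := `[< forall x, sval h x <= sval q x >].
have rP (q h : T) : r q h -> forall x, sval h x <= sval q x by move=> /asboolP.
have [|||A Atot|[q [sq qp]] qmin] := @Zorn T r.
- by move=> q; apply/asboolP.
- move=> q1 q2 q3 /asboolP q12 /asboolP q23; apply/asboolP => x.
  exact: le_trans (q23 x) (q12 x).
- move=> q1 q2 /asboolP q12 /asboolP q21; apply: TP; apply/funext => x.
  by apply/eqP; rewrite eq_le q21 q12.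
(* The empty chain is bounded by [p] itself. *)
- have [[q0 Aq0]|A0] := pselect (A !=set0); last first.
    exists (exist _ p (conj sp (fun x => lexx _))) => q Aq.
    by exfalso; apply: A0; exists q.
  have [||||q sq qle] := sublinear_inf [set sval h | h in A].
  + by exists (sval q0), q0.
  + by move=> x; exists (- p (- x)) => _ [h _ <-]; exact: Tlow.
  (* The smaller of the two functionals serves at both points. *)
  + move=> _ _ x y [h1 A1 <-] [h2 A2 <-].
    have [/rP h12|/rP h21] := Atot _ _ A1 A2.
    * exists (sval h2); first by exists h2.
      have [sD _] := (svalP h2).1; apply: le_trans (sD x y) _.
      by rewrite lerD2r.
    * exists (sval h1); first by exists h1.
      have [sD _] := (svalP h1).1; apply: le_trans (sD x y) _.
      by rewrite lerD2l.
  + move=> _ a x [h Ah <-] a0; exists (sval h); first by exists h.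
    exact: (svalP h).1.2.
  have qp x : q x <= p x.
    apply: le_trans (qle x (sval q0) _) ((svalP q0).2 x).
    by exists q0.
  exists (exist _ q (conj sq qp)) => h Ah; apply/asboolP => x /=.
  by apply: qle; exists h.
exists q => //; split=> // h sh hq.
have hp x : h x <= p x by exact: le_trans (hq x) (qp x).
by have /(_ (asboolT hq))[] := qmin (exist _ h (conj sh hp)).
Qed.

(* Minimality is tested against the inf-convolution of q with the ray through
   (x, - q x), which forces q (- x) <= - q x. *)
Lemma minimal_sublinearN q : sublinear q ->
    (forall h, sublinear h -> (forall x, h x <= q x) -> h = q) ->
  forall x, q (- x) = - q x.
Proof.
move=> sq qmin x.
pose C v s := exists2 a, 0 <= a & v = a *: x /\ s = - (a * q x).
have [||h sh [hq hC]] := sublinear_cone q C sq.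
- split.
  + by exists 0; rewrite ?scale0r ?mul0r ?oppr0.
  + move=> _ _ _ _ [a a0 [-> ->]] [b b0 [-> ->]]; exists (a + b).
      exact: addr_ge0.
    by rewrite scalerDl mulrDl opprD.
  + move=> a _ _ a0 [b b0 [-> ->]]; exists (a * b); first exact: mulr_ge0.
    by rewrite scalerA mulrN mulrA.
- move=> _ _ [a a0 [-> ->]]; rewrite subr_ge0.
  move: a0; rewrite le_eqVlt => /predU1P[<-|a0].
    by rewrite scale0r mul0r (sublinear0 q sq).
  have := sq.2 a^-1 (a *: x); rewrite scalerA mulVf ?gt_eqF // scale1r.
  by rewrite invr_ge0 ler_pdivlMl // => /(_ (ltW a0)).
apply/eqP; rewrite eq_le; apply/andP; split.
  rewrite -{1}(qmin h sh hq); apply: hC.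
  by exists 1; rewrite ?scale1r ?mul1r.
have := sublinearN_ge q 0 x sq.
rewrite addr0 (sublinear0 q sq); have := sq.1 x (- x).
by rewrite subrr (sublinear0 q sq); lra.
Qed.

(** The inf-convolution [q] absorbs the constraints: a linear [g] below [q] has
    [g (- v) <= q (- v) <= s]. A minimal sublinear functional below [q] is odd, and oddness turns
    the sublinear inequalities into equalities. *)
Theorem Hahn_Banach_cone p (C : V -> R -> Prop) :
    sublinear p -> convex_cone C -> (forall v s, C v s -> 0 <= p v + s) ->
  exists2 g : {scalar V}, (forall x, g x <= p x) &
    forall v s, C v s -> 0 <= g v + s.
Proof.
move=> sp cC Cp.
have [q sq [qp qC]] := sublinear_cone p C sp cC Cp.
have [g sg [gq gmin]] := minimal_sublinear q sq.
have gN := minimal_sublinearN g sg gmin.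
have gD x y : g (x + y) = g x + g y.
  apply/eqP; rewrite eq_le sg.1 /=.
  have := sg.1 (x + y) (- y); rewrite addrK gN; lra.
have gZ0 a x : 0 <= a -> g (a *: x) = a * g x.
  move=> a0; apply/eqP; rewrite eq_le sg.2 //=.
  have := sg.2 a (- x) a0; rewrite scalerN !gN; lra.
have gZ a x : g (a *: x) = a * g x.
  have [/gZ0 //|a0] := leP 0 a.
  by rewrite -[a]opprK scaleNr gN gZ0 ?mulNr // oppr_ge0 ltW.
have glin : scalar g by move=> a x y; rewrite gD gZ.
pose G : {scalar V} := HB.pack g (GRing.isLinear.Build _ _ _ _ g glin).
exists G => [x|v s Cvs]; first exact: le_trans (gq x) (qp x).
have := le_trans (gq (- v)) (qC v s Cvs).
by rewrite /G /= gN; lra.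
Qed.

End Sublinear.

(* X with scalars restricted to R. *)
Definition realified {R : realType} (X : lmodType R[i]) : Type := X.

(** * Restriction of scalars and complexification of real functionals *)

Section Realified.
Context {R : realType} {X : lmodType R[i]}.

HB.instance Definition _ := GRing.Zmodule.on (realified X).

Let real_scale (a : R) (x : realified X) : realified X := a%:C%C *: (x : X).

Let real_scaleA a b x : real_scale a (real_scale b x) = real_scale (a * b) x.
Proof. by rewrite /real_scale scalerA rmorphM. Qed.

Let real_scale1 : left_id 1 real_scale.
Proof. by move=> x; rewrite /real_scale rmorph1 scale1r. Qed.

Let real_scaleDr : right_distributive real_scale +%R.
Proof. by move=> a x y; rewrite /real_scale scalerDr. Qed.

Let real_scaleDl x : {morph real_scale^~ x : a b / a + b}.
Proof. by move=> a b; rewrite /real_scale rmorphD scalerDl. Qed.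

HB.instance Definition _ := GRing.Zmodule_isLmodule.Build R (realified X)
  real_scaleA real_scale1 real_scaleDr real_scaleDl.

Lemma realified_scaleE (a : R) (x : X) :
  a *: (x : realified X) = a%:C%C *: x :> X.
Proof. by []. Qed.

(** The classical formula [g x - i g (i x)] for the complex functional with real part [g];
    compatibility with [i] comes from [g (i (i x)) = - g x]. *)
Lemma complexify_scalar (g : {scalar realified X}) :
  scalar (fun x : X => (g x +i* - g ('i%C *: x))%C : R[i]).
Proof.
have gD (x y : X) : g (x + y) = g x + g y := raddfD g x y.
have gZr a (x : X) : g (a%:C%C *: x) = a * g x := scalarZ g a x.
have gi (x : X) : g ('i%C *: ('i%C *: x)) = - g x.
  by rewrite scalerA -expr2 sqr_i scaleN1r; exact: (raddfN g).
have gZ a b (x : X) : g ((a +i* b)%C *: x) = a * g x + b * g ('i%C *: x).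
  rewrite [X in X *: x]complexE scalerDl (mulrC 'i%C) -scalerA /=.
  by rewrite gD !gZr.
move=> [a b] x y; rewrite gD scalerDr gD gZ.
rewrite scalerA (mulrC 'i%C) -scalerA gZ gi.
by apply/eqP; rewrite eq_complex /=; apply/andP; split; apply/eqP; ring.
Qed.

End Realified.

(** * Closed subspaces and their joins *)

Section Subspaces.
Context {K : numFieldType} {X : normedModType K}.
Implicit Types (x y : X) (M N Y : set X) (F : set (set X)).

Lemma closed_subspaceP Y : closed_subspace Y ->
  [/\ Y 0, forall x y, Y x -> Y y -> Y (x + y) & forall a x, Y x -> Y (a *: x)].
Proof.
move=> [[/set_mem Y0 Ylin] _].
have YP a x y : Y x -> Y y -> Y (a *: x + y).
  by move=> Yx Yy; apply/set_mem/Ylin; exact/mem_set.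
split=> // [x y Yx Yy|a x Yx]; first by rewrite -[x]scale1r; exact: YP.
by rewrite -[_ *: _]addr0; exact: YP.
Qed.

Lemma sub_join F N : F N -> N `<=` join F.
Proof.
move=> FN x Nx; apply: subset_closure; exists 1%N, (fun=> 1), (fun=> x).
by split=> [_|]; [exists N|rewrite big_ord1 scale1r].
Qed.

Lemma closed_subspace_sum N n (a : 'I_n -> K) (v : 'I_n -> X) :
  closed_subspace N -> (forall i, N (v i)) -> N (\sum_i a i *: v i).
Proof.
move=> /closed_subspaceP[N0 ND NZ] Nv.
by elim/big_ind: _ => // i _; exact: NZ.
Qed.

Lemma join_sub F N : closed_subspace N -> (forall M, F M -> M `<=` N) ->
  join F `<=` N.
Proof.
move=> sN FN; rewrite [X in _ `<=` X]((closure_id N).1 sN.2).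
apply: closureS => _ [n [a [v [Fv ->]]]]; apply: closed_subspace_sum => // i.
by have [M FM] := Fv i; exact: FN.
Qed.

End Subspaces.

(** * Separation of a point from a closed subspace *)

Section Separation.
Context {R : realType} {X : normedModType R[i]}.
Implicit Types (x y : X) (Y : set X).

(** The norm takes its values in [R[i]]; its real part is the [R]-valued norm needed for the real
    Hahn-Banach theorem. *)
Lemma complex_Re_norm x : (complex.Re `|x|)%:C%C = `|x|.
Proof. by rewrite RRe_real ?normr_real. Qed.

Lemma sublinear_norm :
  sublinear (fun x : realified X => complex.Re `|x : X|).
Proof.
split=> [x y|a x a0]; rewrite -lecR.
  by rewrite rmorphD /= !complex_Re_norm ler_normD.
by rewrite rmorphM /= !complex_Re_norm realified_scaleE normrZ ger0_norm ?ler0c.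
Qed.

Lemma closed_dist Y x : closed Y -> ~ Y x ->
  exists2 d : R, 0 < d & forall y, Y y -> d <= complex.Re `|x - y|.
Proof.
move=> cY Yx.
have : nbhs x (~` Y) by apply: open_nbhs_nbhs; split=> //; exact: closed_openC.
move=> /nbhs_normP[e /= e0 eY]; have eE := RRe_real (gtr0_real e0).
exists (complex.Re e) => [|y Yy]; first by rewrite -ltcR eE.
rewrite -lecR eE complex_Re_norm real_leNgt ?normr_real ?gtr0_real //.
by apply/negP => /eY.
Qed.

(** Hahn-Banach below the norm gives a real functional [g], which is then complexified. The factor 2
    is a crude bound: real and imaginary parts are each at most the norm. *)
Lemma separating_functional Y x : closed_subspace Y -> ~ Y x ->
  exists f : {scalar X}, [/\ forall z, `|f z| <= 2 * `|z|,
    forall y, Y y -> f y = 0 & f x != 0].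
Proof.
move=> sY Yx; have [Y0 YD YZ] := closed_subspaceP Y sY.
have YN y : Y y -> Y (- y) by rewrite -scaleN1r; exact: YZ.
have [d d0 dY] := closed_dist Y x sY.2 Yx.
(* Nonnegativity of v |-> g v + s on this cone says g x >= d and g = 0 on Y. *)
pose C (v : realified X) (s : R) := exists y (t : R),
  [/\ Y y, 0 <= t & v = t%:C%C *: x - y :> X /\ s = - (t * d)].
have [||g gp gC] := Hahn_Banach_cone _ C sublinear_norm.
- split.
  + by exists 0, 0; rewrite scale0r subr0 mul0r oppr0.
  + move=> _ _ _ _ [y [t [Yy t0 [-> ->]]]] [z [u [Yz u0 [-> ->]]]].
    exists (y + z), (t + u); split; [exact: YD|exact: addr_ge0|].
    split; last by rewrite mulrDl opprD.
    by rewrite rmorphD scalerDl opprD (addrACA (_ : X)).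
  + move=> a _ _ a0 [y [t [Yy t0 [-> ->]]]].
    exists (a%:C%C *: y), (a * t); split; [exact: YZ|exact: mulr_ge0|].
    split; last by rewrite mulrN mulrA.
    by rewrite realified_scaleE scalerBr scalerA -rmorphM.
- move=> _ _ [y [t [Yy t0 [-> ->]]]]; rewrite subr_ge0.
  move: t0; rewrite le_eqVlt => /predU1P[<-|t0].
    by rewrite mul0r -lecR complex_Re_norm; exact: normr_ge0.
  have tC0 : 0 < t%:C%C :> R[i] by rewrite ltcR.
  (* Dividing by [t] reduces the claim to the distance from [x] to the point [y / t] of [Y]. *)
  rewrite -ler_pdivlMl //; apply: le_trans (dY (t%:C%C^-1 *: y) (YZ _ _ Yy)) _.
  rewrite ler_pdivlMl // -lecR rmorphM /= !complex_Re_norm.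
  rewrite -{1}(gtr0_norm tC0) -normrZ scalerBr scalerA divff ?gt_eqF //.
  by rewrite scale1r.
pose f := fun z : X => (g z +i* - g ('i%C *: z))%C.
pose F : {scalar X} :=
  HB.pack f (GRing.isLinear.Build _ _ _ _ f (complexify_scalar g)).
have gN (z : X) : g (- z) = - g z := raddfN g z.
have g_norm z : `|g z| <= complex.Re `|z : X|.
  by rewrite ler_norml lerNl -gN -{1}(normrN (z : X)) !gp.
have gY y : Y y -> g y = 0.
  move=> Yy; have := gC (- y) 0; have := gC y 0.
  have CY z : Y z -> C z 0.
    exists (- z), 0; rewrite scale0r sub0r opprK mul0r oppr0.
    by split=> //; exact: YN.
  move=> /(_ (CY _ Yy)) + /(_ (CY _ (YN _ Yy))); rewrite gN; lra.
exists F; split=> [z|y Yy|].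
- have normi : `|'i%C : R[i]| = 1.
    by rewrite normc_def /= expr0n add0r expr1n sqrtr1.
  have norm_real (a : R) : `|a%:C%C : R[i]| = `|a|%:C%C.
    by rewrite normc_def /= expr0n addr0 sqrtr_sqr.
  rewrite /F /= /f [X in `|X|]complexE /=; apply: le_trans (ler_normD _ _) _.
  rewrite normrM normi mul1r !norm_real normrN mulr2n mulrDl !mul1r.
  apply: lerD; rewrite -complex_Re_norm lecR //.
  by apply: le_trans (g_norm _) _; rewrite normrZ normi mul1r.
- rewrite /F /= /f !gY ?oppr0 //; exact: YZ.
(* The pair [(x, - d)] lies in the cone, so the real part [g x] is at least [d > 0]. *)
- have := gC x (- d); rewrite /F /= /f eq_complex negb_and => gx.
  apply/orP; left; rewrite /= gt_eqF //; apply: lt_le_trans d0 _.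
  rewrite -subr_ge0; apply: gx; exists 0, 1.
  by rewrite scale1r subr0 mul1r.
Qed.

End Separation.

(** * Rank-one operators and strong reflexivity of nests *)

Section RankOneNest.
Context {K : numFieldType} {X : normedModType K}.
Implicit Types (M N : set X) (L : set (set X)).

(** The operator is bounded by [C] times the norm of [e]; a nonzero value of [f] makes [f]
    surjective, so the range is the whole line through [e]. *)
Lemma rank_one_scale (f : {scalar X}) (e : X) (C : K) :
    0 <= C -> (forall x, `|f x| <= C * `|x|) -> (exists x, f x != 0) -> e != 0 ->
  exists A : {linear X -> X},
    [/\ bounded_operators A, rank_one A & forall x, A x = f x *: e].
Proof.
move=> C0 fC [x fx] e0; pose T x := f x *: e.
have Tlin : linear T.
  by move=> a y z; rewrite /T linearP scalerDl scalerA.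
pose A : {linear X -> X} := HB.pack T (GRing.isLinear.Build _ _ _ _ T Tlin).
exists A; split=> //.
- apply/linear_boundedP; exists (C * `|e|); split.
    by rewrite ger0_real // mulr_ge0.
  move=> r Cr y; rewrite /A /= /T normrZ.
  have /ler_wpM2r := fC y => /(_ `|e| (normr_ge0 _)) /le_trans; apply.
  by rewrite mulrAC ler_wpM2r // ltW.
- exists e => //; apply/seteqP; split=> _ [y _ <-]; first by exists (f y).
  exists ((y / f x) *: x) => //.
  by rewrite /A /= /T [f _]scalarZ divfK.
Qed.

Lemma nest_strongly_reflexive L : nest L -> strongly_reflexive L.
Proof.
move=> [[Lsub _ Ljoin Lmeet] Ltot] N LN.
have Llower M : L M -> L (lower L M) by move=> LM; apply: Ljoin => K' [].
have Lstar : L (star L N).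
  by apply: Lmeet => _ [M [LM _] <-]; exact: Llower.
have star_sub M : L M -> ~ M `<=` N -> star L N `<=` lower L M.
  by move=> LM MN x; apply; exists M.
apply/seteqP; split; last first.
  (* If [M] is not inside [N], then [N] is one of the subspaces joined in [lower L M]. *)
  by move=> x Nx _ [M [LM MN] <-]; apply: sub_join Nx.
apply: contrapT => starN; case: (starN); apply: subset_trans (star_sub _ Lstar starN) _.
apply: join_sub (Lsub _ LN) _ => K' [LK starK]; apply: contrapT => KN.
case: (starK); apply: subset_trans (star_sub _ LK KN) _.
apply: join_sub (Lsub _ LK) _ => M [LM KM].
(* Totality enters here: [M] does not contain [K'], hence lies inside it. *)
by have [] := Ltot _ _ LM LK.
Qed.

Lemma subset_Lat_Rk1_Alg L :
  (forall M, L M -> closed_subspace M) -> L `<=` Lat (Rk1 (Alg L)).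
Proof. by move=> Lsub M LM; split=> [|A [[_ +] _]]; [exact: Lsub|exact]. Qed.

End RankOneNest.

Theorem theorem5 (R : realType) (X : completeNormedModType R[i])
    (hdim : dim_at_least X 2) (NN : set (set X)) (hN : nest NN) :
  strongly_reflexive NN /\ NN = Lat (Rk1 (Alg NN)).
Proof.
have sr := nest_strongly_reflexive NN hN; split=> //.
have [[Lsub _ Ljoin _] _] := hN.
apply/seteqP; split; first exact: subset_Lat_Rk1_Alg.
move=> M [sM invM]; have [M0 _ MZ] := closed_subspaceP M sM.
pose N := join [set K | NN K /\ K `<=` M].
have NNN : NN N by apply: Ljoin => K [].
suff -> : M = N by [].
apply/seteqP; split; last by apply: join_sub => // K [].
(* Strong reflexivity replaces [N] by [star NN N], a meet of subspaces [lower NN K]; a point [x] of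
   [M] outside one of them will force [K] into [M]. *)
rewrite -(sr N NNN) => x Mx _ [K [NNK KN] <-]; apply: contrapT => xK.
apply: KN; apply: sub_join; split=> // e Ke.
(* The zero vector is set aside because it yields no rank-one operator. *)
have [-> //|e0] := eqVneq e 0.
have slower : closed_subspace (lower NN K) by apply/Lsub/Ljoin => K' [].
have [f [f2 fK fx]] := separating_functional _ _ slower xK.
have [A [bA rA AE]] := rank_one_scale f e 2 (ler0n _ 2) f2 (ex_intro _ x fx) e0.
have : M (A x).
  apply: invM; last by exists x.
  split=> //; split=> // M' NNM' _ [y M'y <-]; rewrite AE.
  have [_ _ M'Z] := closed_subspaceP M' (Lsub _ NNM').
  (* Either [M'] contains [K], hence [e], or [M'] lies inside [lower NN K], where [f] vanishes. *)
  have [KM'|KM'] := pselect (K `<=` M'); first by apply: M'Z; exact: KM'.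
  rewrite fK; first by rewrite scale0r; have [] := closed_subspaceP _ (Lsub _ NNM').
  exact: (@sub_join _ _ _ M').
(* Since [f x] is nonzero, [e] is recovered from [A x]. *)
by rewrite AE => /(MZ (f x)^-1); rewrite scalerA mulVf // scale1r.
Qed.
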